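(* Let $L,S\ge1$ be integers and let $\beta$ be the positive solution of $L\beta+S\beta^2=1$. Then the set $$\mathcal{J}_{L,S}=\bigl\{\{m\beta+n\beta^2\}\ :\ m,n\in\mathbb{Z}\bigr\}\subset[0,1)$$ can be ordered such that the corresponding sequence is a low-discrepancy sequence in $[0,1)$.
   Context: $\{z\}=z-\lfloor z\rfloor$ denotes the fractional part of $z\in\mathbb{R}$. For a sequence $X=(x_n)_{n\ge0}$ in $[0,1)$, the star-discrepancy of its first $N$ points is $D_N^*(X)=\sup_{0<t<1}\left|\frac{\#\{n:0\le n<N,\ x_n\in[0,t)\}}{N}-t\right|$. The sequence $X$ is a low-discrepancy sequence if $D_N^*(X)=O(N^{-1}\log N)$ as $N\to\infty$. An ordering of a countably infinite set is an enumeration of its elements as a sequence indexed by $n\ge0$.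
   Formalization: The set J_{L,S} is additionally assumed to be infinite (equivalently, β irrational); for rational β, e.g. L=1, S=2, β=1/2, the set is {0,1/4,1/2,3/4}, which is finite and has no such ordering, so the claim fails there. *)

(* Defs.v *)
From mathcomp Require Import all_boot all_order all_algebra.
From mathcomp Require Import all_classical all_reals all_analysis.

Set Implicit Arguments.
Unset Strict Implicit.
Unset Printing Implicit Defensive.

Import Order.TTheory GRing.Theory Num.Theory.
Import numFieldNormedType.Exports.

Local Open Scope classical_set_scope.
Local Open Scope ring_scope.

Definition frac_part (R : realType) (z : R) : R := z - (Num.floor z)%:~R.

(* The supremum is over a nonempty subset of [0, 1], so the totalized [sup] is
   the genuine one.  At N = 0 the quotient is 0 by the convention x / 0 = 0;
   this value plays no role in asymptotic statements. *)
Definition star_discrepancy (R : realType) (x : nat -> R) (N : nat) : R :=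
  sup [set `| #|[pred n : 'I_N | x n \in `[0, t[%R]|%:R / N%:R - t |
        | t in `]0, 1[ ].

Definition low_discrepancy (R : realType) (x : nat -> R) : Prop :=
  (forall n, x n \in `[0, 1[%R) /\
  star_discrepancy x =O_\oo (fun N : nat => (N%:R : R)^-1 * ln N%:R).

(* Every element of [A] is listed exactly once. *)
Definition is_ordering (R : realType) (A : set R) (x : nat -> R) : Prop :=
  set_bij [set: nat] A x.

(* The dependence of this set on (L, S) is through [beta] only. *)
Definition J_LS (R : realType) (beta : R) : set R :=
  [set z | exists m n : int,
     z = frac_part (m%:~R * beta + n%:~R * beta ^+ 2)].

(* Main.v *)
Require Import Defs.
From mathcomp Require Import all_boot all_order all_algebra.
From mathcomp Require Import all_classical all_reals all_analysis.
From mathcomp Require Import zify ring lra.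

Import Order.TTheory GRing.Theory Num.Theory.
Import numFieldNormedType.Exports.

Local Open Scope classical_set_scope.
Local Open Scope ring_scope.

(** Write G for the group Z beta + Z beta^2.  The relation
    L beta + S beta^2 = 1 shows that G contains 1 and that, modulo 1, the
    coordinates (m, n) matter only up to multiples of (L, S).  Hence the
    classes of G modulo 1 are represented by the m beta + n beta^2 with m an
    integer and 0 <= n < S, exactly once each when beta is irrational.  The
    set J is therefore the union of S disjoint translates of the two-sided
    orbit of 0 under the rotation by beta; the ordering interleaves these S
    orbits, and runs through each of them as 0, -1, 1, -2, 2, ...  The first N
    terms then consist, up to fewer than S points, of S runs of consecutive
    orbit points of the rotation ([interleaved_ordering],
    [sum_visits_interleaved]).

    It remains to see that a run of N consecutive points of a shifted orbit
    visits [0, t) N t + O(log N) times, uniformly in t and in the shift.  As a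
    quadratic irrational, beta is badly approximable
    ([beta_badly_approximable]).  By Dirichlet's theorem there is a reduced
    fraction p/q with q <= N and |q beta - p| < 1/N, and bad approximability
    forces q >= c N with a fixed c > 0.  The first q points of the run stay
    close to a shift of the multiples of 1/q, so that their counting error is
    bounded by an absolute constant ([rotation_error_block]).  At most
    (1 - c) N points are left, and the same argument applies to them; after
    O(log N) rounds the run is exhausted ([rotation_error_log]). *)

(** * Fractional parts and floors *)

Lemma frac_part_itv {R : realType} (z : R) : 0 <= frac_part z < 1.
Proof.
have /andP[] := floor_itv z; rewrite /frac_part rmorphD /= => h1 h2.
by apply/andP; split; lra.
Qed.

Lemma frac_partDint {R : realType} (z : R) (n : int) :
  frac_part (z + n%:~R) = frac_part z.
Proof.
rewrite /frac_part; suff -> : Num.floor (z + n%:~R) = Num.floor z + n.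
  by rewrite rmorphD /=; ring.
apply: floor_def; have /andP[] := floor_itv z; rewrite !rmorphD /= => h1 h2.
by apply/andP; split; lra.
Qed.

(** Turning the indicator into a difference of floors makes visit counts
    differences of sums that are monotone in the shift, so that perturbing the
    points needs no discussion of wrapping around modulo 1. *)
Lemma frac_part_lt_floor {R : realType} (t z : R) : 0 < t < 1 ->
  (frac_part z < t)%R%:R = (Num.floor z - Num.floor (z - t))%:~R :> R.
Proof.
move=> /andP[t0 t1]; rewrite /frac_part.
have /andP[] := floor_itv z; rewrite rmorphD /= => h1 h2.
case: ltP => h.
  suff -> : Num.floor (z - t) = Num.floor z - 1 by rewrite opprB addrC subrK.
  by apply: floor_def; rewrite !rmorphD rmorphN /=; apply/andP; split; lra.
suff -> : Num.floor (z - t) = Num.floor z by rewrite subrr.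
by apply: floor_def; rewrite !rmorphD /=; apply/andP; split; lra.
Qed.

Lemma floor_divz {R : realType} (x : int) (q : nat) : (0 < q)%N ->
  Num.floor (x%:~R / q%:R : R) = (x %/ q)%Z.
Proof.
move=> q0; have qR : 0 < q%:R :> R by rewrite ltr0n.
apply: floor_def; rewrite ler_pdivlMr // ltr_pdivrMr //.
rewrite -[q%:R]/((q : int)%:~R) -!rmorphM /= ler_int ltr_int.
have := divz_eq x q; have := modz_ge0 x (d := q); have := ltz_pmod x (d := q).
by move=> h1 h2 h3; apply/andP; split; lia.
Qed.

(** * Counting visits over one good denominator *)

(** The affine map k |-> k p + m permutes the residues modulo q. *)
Lemma sum_modz_coprime (p m : int) (q : nat) : (0 < q)%N -> coprimez p q ->
  \sum_(k < q) ((k%:Z * p + m) %% q)%Z = \sum_(k < q) k%:Z.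
Proof.
case: q => // q _ cpq.
have mod_bound k : 0 <= ((k%:Z * p + m) %% q.+1)%Z < q.+1%:Z.
  by rewrite modz_ge0 // ltz_pmod.
pose f (k : 'I_q.+1) : 'I_q.+1 := inord `|((k%:Z * p + m) %% q.+1)%Z|.
have fE k : (f k)%:Z = ((k%:Z * p + m) %% q.+1)%Z.
  by rewrite /f inordK; have := mod_bound k; lia.
have f_inj : injective f.
  move=> k l fkl; have : f k = f l :> int by rewrite fkl.
  rewrite !fE => /eqP; rewrite eqz_mod_dvd.
  have -> : k%:Z * p + m - (l%:Z * p + m) = (k%:Z - l%:Z) * p by ring.
  rewrite Gauss_dvdzl 1?coprimez_sym // => /dvdzP[w hw].
  apply/val_inj => /=; move: (ltn_ord k) (ltn_ord l) => kq lq.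
  have [w1 w2] : w < 1 /\ -1 < w by split; nia.
  have w0 : w = 0 by lia.
  by move: hw; rewrite w0; lia.
by rewrite [RHS](reindex_inj f_inj); apply: eq_bigr => k _; rewrite fE.
Qed.

(** Multiply by q and write q (x %/ q) = x - x %% q: the remainders have a sum
    independent of m, so only the sum of the k p + m depends on m. *)
Lemma sum_divz_coprime (p m : int) (q : nat) : (0 < q)%N -> coprimez p q ->
  \sum_(k < q) ((k%:Z * p + m) %/ q)%Z = m + \sum_(k < q) ((k%:Z * p) %/ q)%Z.
Proof.
move=> q0 cpq; apply: (@mulIf _ q%:Z); first by lia.
have split_sum n : (\sum_(k < q) ((k%:Z * p + n) %/ q)%Z) * q%:Z
    = \sum_(k < q) k%:Z * p + q%:Z * n - \sum_(k < q) k%:Z.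
  rewrite -(@sum_modz_coprime p n q) // mulr_suml -[q%:Z * n]mulrC.
  have -> : n * q%:Z = \sum_(k < q) n by rewrite sumr_const card_ord -mulr_natr natz.
  rewrite -big_split -sumrB; apply: eq_bigr => k _ /=.
  by rewrite [X in _ = X - _](divz_eq _ q) addrK.
have := split_sum 0; under eq_bigr do rewrite addr0.
by rewrite mulrDl split_sum => ->; ring.
Qed.

(** Along the q points, k a drifts from k p / q by at most 1 / q.  With
    m = floor (q theta), each k a + theta thus lies between (k p + m - 1) / q
    and (k p + m + 2) / q, and monotonicity of the floor sandwiches the sum
    between two instances of [sum_divz_coprime]. *)
Lemma sum_floor_rotation {R : realType} (a theta : R) (p : int) (q : nat) :
  (0 < q)%N -> coprimez p q -> `|q%:R * a - p%:~R| <= q%:R^-1 ->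
  `|(\sum_(k < q) Num.floor (k%:R * a + theta))%:~R
    - (q%:R * theta + (\sum_(k < q) ((k%:Z * p) %/ q)%Z)%:~R)| <= 2.
Proof.
move=> q0 cpq; have qR : 0 < q%:R :> R by rewrite ltr0n.
set m := Num.floor (q%:R * theta); set G := \sum_(k < q) (_ %/ _)%Z.
have /andP[m1 m2] := floor_itv (q%:R * theta); rewrite -/m rmorphD /= in m1 m2.
rewrite ler_norml => /andP[d1 d2].
have drift k : (k < q)%N ->
    - 1 <= k%:R * (q%:R * a - p%:~R) <= 1.
  move=> kq; have kqR : k%:R <= q%:R :> R by rewrite ler_nat ltnW.
  have k0 : 0 <= k%:R :> R by [].
  (* |k (q a - p)| <= q (1 / q) = 1 *)
  have qV : q%:R * q%:R^-1 = 1 :> R by rewrite mulfV // gt_eqF.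
  have qVp : 0 < q%:R^-1 :> R by rewrite invr_gt0.
  by apply/andP; split; nra.
have lo : (m - 1 + G <= \sum_(k < q) Num.floor (k%:R * a + theta))%R.
  rewrite /G -sum_divz_coprime //; apply: ler_sum => k _.
  rewrite -(@floor_divz R) //; apply: le_floor.
  rewrite ler_pdivrMr // !rmorphD rmorphM rmorphN /=.
  by have /andP[] := drift k (ltn_ord k); lra.
have hi : (\sum_(k < q) Num.floor (k%:R * a + theta) <= m + 2 + G)%R.
  rewrite /G -sum_divz_coprime //; apply: ler_sum => k _.
  rewrite -(@floor_divz R) //; apply: le_floor.
  rewrite ler_pdivlMr // !rmorphD rmorphM /=.
  by have /andP[] := drift k (ltn_ord k); lra.
move: lo hi; rewrite -!(ler_int R).
rewrite !rmorphD rmorphN /= => lo hi.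
by rewrite ler_norml; apply/andP; split; lra.
Qed.

Definition rotation_error {R : realType} (a t theta : R) (N : nat) : R :=
  \sum_(k < N) (frac_part (k%:R * a + theta) < t)%R%:R - N%:R * t.

Lemma rotation_errorD {R : realType} (a t theta : R) (M N : nat) :
  rotation_error a t theta (M + N) =
  rotation_error a t theta M + rotation_error a t (M%:R * a + theta) N.
Proof.
rewrite /rotation_error big_split_ord /= natrD.
under [X in _ + X - _ = _]eq_bigr do rewrite natrD mulrDl addrAC addrC addrA.
under [X in _ = _ + (X - _)]eq_bigr do rewrite addrA.
by ring.
Qed.

(** The count is the difference of the floor sums at the shifts theta and
    theta - t; in each the error is at most 2 and the sum of the k p %/ q
    cancels. *)
Lemma rotation_error_block {R : realType} (a t theta : R) (p : int) (q : nat) :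
  0 < t < 1 -> (0 < q)%N -> coprimez p q ->
  `|q%:R * a - p%:~R| <= q%:R^-1 -> `|rotation_error a t theta q| <= 4.
Proof.
move=> t01 q0 cpq close; rewrite /rotation_error.
under eq_bigr do rewrite frac_part_lt_floor // -addrA.
have := @sum_floor_rotation R a theta p q q0 cpq close.
have := @sum_floor_rotation R a (theta - t) p q q0 cpq close.
rewrite -rmorph_sum sumrB rmorphB /= !ler_norml.
by move=> /andP[? ?] /andP[? ?]; apply/andP; split; lra.
Qed.

(** * Rotations by badly approximable numbers *)

(** Two of the N + 1 points k a modulo 1 share one of the N intervals of length
    1 / N.  Dividing numerator and denominator by their gcd only improves the
    approximation. *)
Lemma dirichlet_approximation {R : realType} (a : R) (N : nat) : (0 < N)%N ->
  exists (p : int) (q : nat),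
    [/\ (0 < q <= N)%N, coprimez p q & `|q%:R * a - p%:~R| < N%:R^-1].
Proof.
case: N => // N _; have NR : 0 < N.+1%:R :> R by rewrite ltr0n.
pose u (k : 'I_N.+2) : R := N.+1%:R * frac_part (k%:R * a).
pose bin k : 'I_N.+1 := inord `|Num.floor (u k)|.
have binE k : (bin k)%:Z = Num.floor (u k).
  have /andP[f0 f1] := frac_part_itv (k%:R * a).
  have u0 : 0 <= Num.floor (u k) by rewrite floor_ge0 /u mulr_ge0 // ltW.
  have u1 : Num.floor (u k) < N.+1.
    by rewrite floor_lt_int -[N.+1%:~R]/(N.+1%:R) /u; nra.
  by rewrite /bin inordK; lia.
have [k [l [kl bin_kl]]] : exists k l : 'I_N.+2, (k < l)%N /\ bin k = bin l.
  have /injectivePn[k [l kl e]] : ~~ injectiveb bin.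
    by apply/negP => /injectiveP /leq_card; rewrite !card_ord ltnn.
  by case: (ltngtP k l) => h; [exists k, l|exists l, k|case/eqP: kl; exact/val_inj].
pose P := Num.floor (l%:R * a) - Num.floor (k%:R * a).
have close : `|(l - k)%:R * a - P%:~R| < N.+1%:R^-1 :> R.
  have -> : (l - k)%:R * a - P%:~R = (u l - u k) / N.+1%:R.
    rewrite /u /P /frac_part natrB 1?ltnW // rmorphB /=; field.
    by rewrite gt_eqF // -natr1 // addrC.
  rewrite normrM (gtr0_norm (_ : 0 < N.+1%:R^-1)) ?invr_gt0 //.
  rewrite gtr_pMl ?invr_gt0 //.
  have /andP[] := floor_itv (u l); have /andP[] := floor_itv (u k).
  rewrite -!binE bin_kl !rmorphD /= => *.
  by rewrite ltr_norml; apply/andP; split; lra.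
have q0 : (0 < l - k)%N by rewrite subn_gt0.
pose g := gcdn (l - k) `|P|; have g0 : (0 < g)%N by rewrite gcdn_gt0 q0.
have [q' qE] : exists q', (l - k)%N = (q' * g)%N by apply/dvdnP/dvdn_gcdl.
have [p' pE] : exists p', P = p' * g%:Z.
  by apply/dvdzP; rewrite /dvdz; exact: dvdn_gcdr.
have q'0 : (0 < q')%N by move: q0; rewrite qE muln_gt0 => /andP[].
exists p', q'; split.
- by rewrite q'0 /=; have := ltn_ord l; nia.
- rewrite coprimezE /coprime -(eqn_pmul2r g0) mul1n muln_gcdl /= gcdnC.
  have gE : gcdn (l - k) `|P| = g by [].
  by rewrite -qE -[X in _ == X]gE pE abszM.
- apply: le_lt_trans close; rewrite qE pE natrM rmorphM /=.
  have -> : q'%:R * g%:R * a - p'%:~R * g%:Z%:~R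
      = (q'%:R * a - p'%:~R) * g%:R :> R.
    by rewrite -[g%:Z%:~R]/(g%:R : R); ring.
  by rewrite normrM ler_peMr // ger0_norm // ler1n.
Qed.

Definition badly_approximable {R : realType} (c a : R) : Prop :=
  forall (p : int) (q : nat), (0 < q)%N -> c <= q%:R * `|q%:R * a - p%:~R|.

(** The constant K = - 1 / ln (1 - c) makes K ln N drop by at least 1 when N is
    replaced by N - q <= (1 - c) N, which pays for the error 4 of the block of
    length q. *)
Lemma rotation_error_log {R : realType} (c a : R) : 0 < c < 1 ->
  badly_approximable c a ->
  exists2 K : R, 0 < K & forall (t theta : R) (N : nat), 0 < t < 1 ->
    (0 < N)%N -> `|rotation_error a t theta N| <= 4 * (1 + K * ln N%:R).
Proof.
move=> /andP[c0 c1] bad; have ln_lt : ln (1 - c) < 0.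
  by rewrite ln_lt0 //; apply/andP; split; lra.
exists (- (ln (1 - c))^-1); first by rewrite oppr_gt0 invr_lt0.
set K := - _; have Kln : K * ln (1 - c) = -1 by rewrite mulNr mulVf // lt_eqF.
have K0 : 0 < K by rewrite oppr_gt0 invr_lt0.
move=> t theta N t01; elim/ltn_ind: N theta => N IH theta N0.
have NR : 0 < N%:R :> R by rewrite ltr0n.
have [p [q [/andP[q0 qN] cpq close]]] := @dirichlet_approximation R a N N0.
have qR : 0 < q%:R :> R by rewrite ltr0n.
have qNR : q%:R <= N%:R :> R by rewrite ler_nat.
have cN : c * N%:R <= q%:R.
  have := bad p q q0; rewrite -ler_pdivrMl // => h.
  have := le_lt_trans h close.
  by rewrite mulrC ltr_pdivrMr // mulrC ltr_pdivlMr // => /ltW.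
have block : `|rotation_error a t theta q| <= 4.
  apply: rotation_error_block cpq _ => //; apply: le_trans (ltW close) _.
  by rewrite lef_pV2 ?posrE.
have lnN0 : 0 <= ln (N%:R : R) by rewrite ln_ge0 // ler1n.
have [qE|qltN] := eqVneq q N.
  by move: block; rewrite qE => /le_trans; apply; nra.
have {}qltN : (q < N)%N by rewrite ltn_neqAle qltN.
rewrite -(subnKC qN) rotation_errorD (subnKC qN).
apply: le_trans (ler_normD _ _) _.
have rest := IH (N - q)%N _ (q%:R * a + theta) _.
have {}rest := rest ltac:(by rewrite ltn_subrL q0) ltac:(by rewrite subn_gt0).
have ln_rest : ln ((N - q)%:R : R) <= ln (1 - c) + ln N%:R.
  have c10 : 0 < 1 - c by lra.
  rewrite -lnM ?posrE // ler_ln ?posrE ?mulr_gt0 // ?ltr0n ?subn_gt0 //.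
  by rewrite natrB //; lra.
have : K * ln ((N - q)%:R : R) <= K * (ln (1 - c) + ln N%:R).
  by rewrite ler_pM2l.
by rewrite mulrDr Kln; lra.
Qed.

Lemma rotation_error_log_le {R : realType} (a t theta K : R) (M N : nat) :
  0 < K ->
  (forall theta' M', (0 < M')%N ->
     `|rotation_error a t theta' M'| <= 4 * (1 + K * ln M'%:R)) ->
  (M <= N)%N -> (0 < N)%N ->
  `|rotation_error a t theta M| <= 4 * (1 + K * ln N%:R).
Proof.
move=> K0 bound MN N0; case: M MN => [|M] MN.
  rewrite /rotation_error big_ord0 mul0r subrr normr0.
  by rewrite mulr_ge0 // addr_ge0 // mulr_ge0 ?ln_ge0 ?ler1n // ltW.
apply: le_trans (bound _ _ _) _ => //; rewrite ler_pM2l // lerD2l ler_pM2l //.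
by rewrite ler_ln ?posrE ?ltr0n // ler_nat.
Qed.

(** * The arithmetic of beta *)

(** If beta = b / a, every element of J is a multiple of 1 / a^2 in [0, 1). *)
Lemma beta_irrational {R : realType} (beta : R) :
  infinite_set (J_LS beta) ->
  forall a b : int, a%:~R * beta = b%:~R -> a = 0.
Proof.
move=> Jinf a b ab; apply/eqP/negPn/negP => a0; apply: Jinf.
pose D := (`|a| ^ 2)%N; have D0 : (0 < D)%N by rewrite expn_gt0 absz_gt0 a0.
have DR : D%:R = a%:~R ^+ 2 :> R.
  by rewrite -[D%:R]/(D%:Z%:~R) -rmorphXn /D -abszX gez0_abs // sqr_ge0.
apply: (@sub_finite_set _ _ ((fun r : nat => r%:R / D%:R : R) @` `I_D)); last first.
  exact/finite_image/finite_II.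
move=> _ [m [n ->]] /=; pose w : int := m * a * b + n * b ^+ 2.
have aR : a%:~R != 0 :> R by rewrite intr_eq0.
have -> : m%:~R * beta + n%:~R * beta ^+ 2 = w%:~R / D%:R.
  have -> : beta = b%:~R / a%:~R by rewrite -ab mulrAC mulfV // mul1r.
  by rewrite /w DR rmorphD !rmorphM ?rmorphXn /=; field.
have r0 : 0 <= (w %% D)%Z by rewrite modz_ge0 //; lia.
have rD : (w %% D)%Z < D%:Z by rewrite ltz_pmod.
exists `|(w %% D)%Z|%N; first by lia.
rewrite /frac_part floor_divz //.
have -> : `|(w %% D)%Z|%N%:R = (w %% D)%Z%:~R :> R.
  by rewrite -[LHS]/(`|(w %% D)%Z|%N%:Z%:~R) gez0_abs //; lia.
have wE : w%:~R = (w %/ D)%Z%:~R * D%:R + (w %% D)%Z%:~R :> R.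
  by rewrite [in LHS](divz_eq w D) rmorphD rmorphM.
rewrite wE; field.
by rewrite pnatr_eq0 -lt0n.
Qed.

(** The integer S p^2 + L p q - q^2 is nonzero, hence at least 1 in absolute
    value.  It factors as p - q beta times a conjugate factor, which is O(q) as
    soon as |q beta - p| < 1. *)
Lemma beta_badly_approximable {R : realType} (L S : nat) (beta : R) :
  (1 <= S)%N -> 0 < beta -> L%:R * beta + S%:R * beta ^+ 2 = 1 ->
  (forall a b : int, a%:~R * beta = b%:~R -> a = 0) ->
  badly_approximable (S%:R + 2 * S%:R * beta + L%:R)^-1 beta.
Proof.
move=> S1 b0 beq irr p q q0; set T := S%:R + 2 * S%:R * beta + L%:R.
have SR : 1 <= S%:R :> R by rewrite ler1n.
have LR : 0 <= L%:R :> R by [].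
have qR : 1 <= q%:R :> R by rewrite ler1n.
have T1 : 1 <= T by rewrite /T; nra.
have T0 : 0 < T by lra.
have [big|small] := lerP 1 `|q%:R * beta - p%:~R|.
  have : T^-1 <= 1 by rewrite invf_le1.
  by nra.
pose v : int := S%:Z * p ^+ 2 + L%:Z * p * q%:Z - q%:Z ^+ 2.
(* p - q beta', up to the factor S, where beta' = - L / S - beta is the other
   root of S X^2 + L X - 1 *)
pose conj : R := S%:R * p%:~R + S%:R * beta * q%:R + L%:R * q%:R.
have vE : v%:~R = (p%:~R - q%:R * beta) * conj :> R.
  rewrite /v /conj rmorphB rmorphD !rmorphM ?rmorphXn /=.
  by rewrite -[q%:Z%:~R]/(q%:R : R) -[S%:Z%:~R]/(S%:R : R) -[L%:Z%:~R]/(L%:R : R); nra.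
have v0 : v != 0.
  apply/eqP => v0; move/eqP: vE; rewrite v0 eq_sym mulf_eq0 => /orP[] /eqP h.
    by have := irr q p ltac:(by rewrite -[q%:Z%:~R]/(q%:R : R); lra); lia.
  have := irr (S%:Z * q%:Z) (- (S%:Z * p + L%:Z * q%:Z)).
  rewrite rmorphN rmorphD !rmorphM /=.
  rewrite -[q%:Z%:~R]/(q%:R : R) -[S%:Z%:~R]/(S%:R : R) -[L%:Z%:~R]/(L%:R : R).
  move=> /(_ ltac:(by rewrite /conj in h; lra)); nia.
have v1 : 1 <= `|q%:R * beta - p%:~R| * `|conj|.
  by rewrite distrC -normrM -vE -intr_norm -[1]/(1%:~R) ler_int -gtz0_ge1 normr_gt0.
have conj_le : `|conj| <= T * q%:R.
  have -> : conj = S%:R * (p%:~R - q%:R * beta)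
      + (2 * S%:R * beta + L%:R) * q%:R by rewrite /conj; ring.
  apply: le_trans (ler_normD _ _) _.
  rewrite normrM distrC (ger0_norm (_ : 0 <= S%:R)) //.
  rewrite (@ger0_norm _ (_ * q%:R)); last first.
    by rewrite mulr_ge0 // addr_ge0 // mulr_ge0 // ltW.
  have : S%:R * `|q%:R * beta - p%:~R| <= S%:R * q%:R.
    by rewrite ler_wpM2l //; lra.
  by rewrite /T; lra.
rewrite -[leLHS]mul1r ler_pdivrMr //; apply: le_trans v1 _.
by rewrite [leRHS]mulrAC [q%:R * T]mulrC [leRHS]mulrC ler_wpM2l.
Qed.

(** * The ordering *)

Definition zigzag (k : nat) : int := if odd k then Negz k./2 else Posz k./2.

Lemma zigzag_inj : injective zigzag.
Proof.
move=> k l; rewrite /zigzag => h.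
rewrite -(odd_double_half k) -(odd_double_half l); move: h.
by case: (odd k); case: (odd l) => // -[->].
Qed.

Lemma zigzag_surj (m : int) : exists k, zigzag k = m.
Proof.
case: m => m; [exists m.*2|exists m.*2.+1]; rewrite /zigzag /=.
  by rewrite odd_double doubleK.
by rewrite odd_double /= uphalf_double.
Qed.

(** The first M values of [zigzag] fill the integer interval
    [- M./2, uphalf M); the negative ones are listed upwards on the right, so
    that both sums run forward along an orbit. *)
Lemma sum_zigzag {V : zmodType} (f : int -> V) (M : nat) :
  \sum_(k < M) f (zigzag k) =
  \sum_(k < uphalf M) f k%:Z + \sum_(k < M./2) f (k%:Z - M./2%:Z).
Proof.
have -> : \sum_(k < M./2) f (k%:Z - M./2%:Z) = \sum_(k < M./2) f (Negz k).
  rewrite [LHS](reindex_inj rev_ord_inj); apply: eq_bigr => k _ /=.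
  by congr f; have := ltn_ord k; lia.
elim: M => [|M IH]; first by rewrite !big_ord0 addr0.
rewrite big_ord_recr IH /= /zigzag uphalf_half.
case: (odd M); rewrite ?add0n ?add1n big_ord_recr /= ?addrA //.
  by rewrite big_ord_recr addrA.
by rewrite addrAC.
Qed.

Lemma sum_divn_modn {V : zmodType} (g : nat -> nat -> V) (M S : nat) :
  (0 < S)%N ->
  \sum_(i < M * S) g (i %/ S)%N (i %% S)%N = \sum_(n < S) \sum_(k < M) g k n.
Proof.
move=> S0; rewrite exchange_big /=.
elim: M => [|M IH]; first by rewrite !big_ord0.
rewrite mulSnr big_split_ord /= IH big_ord_recr /=; congr (_ + _).
apply: eq_bigr => j _.
by rewrite divnMDl // modnMDl modn_small // divn_small // addn0.
Qed.

Definition interleaved {R : realType} (S : nat) (beta : R) (i : nat) : R :=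
  (zigzag (i %/ S))%:~R * beta + (i %% S)%:R * beta ^+ 2.

(** Equality modulo 1 of two terms gives an integer relation between beta and 1,
    whose coefficients vanish: the two values of n are congruent modulo S, hence
    equal, and then so are the values of m.  For surjectivity, n is reduced
    modulo S by subtracting a multiple of L beta + S beta^2 = 1. *)
Lemma interleaved_ordering {R : realType} (L S : nat) (beta : R) :
  (1 <= S)%N -> L%:R * beta + S%:R * beta ^+ 2 = 1 ->
  (forall a b : int, a%:~R * beta = b%:~R -> a = 0) ->
  is_ordering (J_LS beta) (fun i => frac_part (interleaved S beta i)).
Proof.
move=> S1 beq irr; split.
- by move=> i _; exists (zigzag (i %/ S)), (i %% S)%N%:Z.
- move=> i j _ _; rewrite /frac_part.
  set z1 := Num.floor _; set z2 := Num.floor _; rewrite /interleaved => h.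
  have ltS k : (k %% S < S)%N by rewrite ltn_mod.
  pose dn : int := (i %% S)%N%:Z - (j %% S)%N%:Z.
  pose dm := zigzag (i %/ S) - zigzag (j %/ S).
  have rel : (S%:Z * dm - L%:Z * dn)%:~R * beta = (S%:Z * (z1 - z2) - dn)%:~R.
    rewrite /dm /dn !rmorphB !rmorphM !rmorphB /=.
    rewrite -[S%:Z%:~R]/(S%:R : R) -[L%:Z%:~R]/(L%:R : R).
    rewrite -[(i %% S)%N%:Z%:~R]/((i %% S)%:R : R).
    rewrite -[(j %% S)%N%:Z%:~R]/((j %% S)%:R : R).
    have hS := congr1 ( *%R^~ S%:R) h.
    have hn := congr1 ( *%R^~ ((i %% S)%:R - (j %% S)%:R)) beq.
    by move: hS hn => /= hS hn; lra.
  have c0 := irr _ _ rel; move: rel; rewrite c0 mul0r => /esym/eqP.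
  rewrite intr_eq0 => /eqP d0.
  have := ltS i; have := ltS j => ltj lti.
  have [z1lt z2lt] : z1 - z2 < 1 /\ -1 < z1 - z2 by split; nia.
  have zz : z1 - z2 = 0 by lia.
  have dn0 : dn = 0 by move: d0; rewrite zz; lia.
  have dm0 : dm = 0 by move: c0; rewrite dn0; nia.
  rewrite (divn_eq i S) (divn_eq j S); congr (_ * _ + _)%N; last by lia.
  by apply: zigzag_inj; apply/eqP; rewrite -subr_eq0; apply/eqP.
- move=> _ [m [n ->]].
  have S0 : 0 < S%:Z by lia.
  have r0 : 0 <= (n %% S)%Z by rewrite modz_ge0 //; lia.
  have rS := ltz_pmod n S0.
  have [k kE] := zigzag_surj (m - (n %/ S)%Z * L).
  exists (k * S + `|(n %% S)%Z|%N)%N => //=.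
  rewrite /interleaved divnMDl // modnMDl modn_small ?divn_small ?addn0; try lia.
  rewrite kE -(frac_partDint _ (n %/ S)%Z); congr frac_part.
  have -> : `|(n %% S)%Z|%N%:R = (n %% S)%Z%:~R :> R.
    by rewrite -[LHS]/(`|(n %% S)%Z|%N%:Z%:~R) gez0_abs //; lia.
  have nE : n%:~R = (n %/ S)%Z%:~R * S%:R + (n %% S)%Z%:~R :> R.
    by rewrite [in LHS](divz_eq n S) rmorphD rmorphM.
  rewrite nE rmorphB rmorphM /= -[L%:Z%:~R]/(L%:R : R).
  have := congr1 ( *%R^~ (n %/ S)%Z%:~R) beq => /=; lra.
Qed.

(** * Discrepancy of the ordering *)

Lemma star_discrepancy_le {R : realType} (x : nat -> R) (N : nat) (B : R) :
  (0 < N)%N -> (forall n, 0 <= x n) ->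
  (forall t, 0 < t < 1 ->
    `|\sum_(n < N) (x n < t)%R%:R - N%:R * t| <= B) ->
  `|star_discrepancy x N| <= B / N%:R.
Proof.
move=> N0 x0 bound; have NR : 0 < N%:R :> R by rewrite ltr0n.
rewrite /star_discrepancy; set E := [set _ | _ in _].
have E_ub : ubound E (B / N%:R).
  move=> y [t /=]; rewrite in_itv /= => t01 <-; rewrite ler_pdivlMr //.
  have -> : #|[pred n : 'I_N | x n \in `[0, t[%R]|%:R
      = \sum_(n < N) (x n < t)%R%:R :> R.
    rewrite -sum1_card big_mkcond natr_sum /=; apply: eq_bigr => n _.
    by rewrite inE /= in_itv /= x0 /=; case: ifP.
  rewrite -{2}(gtr0_norm NR) -normrM mulrBl divfK ?gt_eqF // [t * _]mulrC.
  exact: bound.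
have [y y0 Ey] : exists2 y, 0 <= y & E y.
  by eexists; last by exists 2^-1; [rewrite /= in_itv /=; lra|reflexivity].
rewrite ger0_norm; first by apply: ge_sup => //; exists y.
apply: le_trans y0 _; apply: ub_le_sup Ey.
by exists (B / N%:R).
Qed.

(** The first M S terms, M = N %/ S, form S columns of M points each, and every
    column splits into two forward runs of the rotation: hence the 2 B.  The
    fewer than S remaining terms account for the 1. *)
Lemma sum_visits_interleaved {R : realType} (S N : nat) (beta t B : R) :
  (0 < S)%N -> 0 < t < 1 ->
  (forall theta M, (M <= N)%N -> `|rotation_error beta t theta M| <= B) ->
  `|\sum_(i < N) (frac_part (interleaved S beta i) < t)%R%:R - N%:R * t|
    <= S%:R * (2 * B + 1).
Proof.
move=> S0 /andP[t0 t1] bound; pose M := (N %/ S)%N.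
pose visit (k n : nat) : R :=
  (frac_part ((zigzag k)%:~R * beta + n%:R * beta ^+ 2) < t)%R%:R.
have column n : `|\sum_(k < M) visit k n - M%:R * t| <= 2 * B.
  have MN : (M <= N)%N by exact: leq_div.
  pose f (m : int) : R := (frac_part (m%:~R * beta + n%:R * beta ^+ 2) < t)%R%:R.
  have -> : \sum_(k < M) visit k n = \sum_(k < M) f (zigzag k) by [].
  have back (k : 'I_M./2) : f (k%:Z - M./2%:Z) =
      (frac_part (k%:R * beta + (n%:R * beta ^+ 2 - M./2%:R * beta)) < t)%R%:R.
    by rewrite /f rmorphB /= mulrBl addrAC addrA.
  rewrite sum_zigzag; rewrite (eq_bigr _ (fun k _ => back k)).
  have -> : M%:R = (uphalf M)%:R + M./2%:R :> R.
    by rewrite -natrD uphalf_half -addnA addnn odd_double_half.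
  have h1 := bound (n%:R * beta ^+ 2) (uphalf M) ltac:(lia).
  have h2 := bound (n%:R * beta ^+ 2 - M./2%:R * beta) M./2 ltac:(lia).
  have := ler_normD (rotation_error beta t (n%:R * beta ^+ 2) (uphalf M))
    (rotation_error beta t (n%:R * beta ^+ 2 - M./2%:R * beta) M./2).
  rewrite [X in `|X| <= _ -> _](_ : _ = \sum_(k < uphalf M) f k%:Z
    + \sum_(k < M./2)
        (frac_part (k%:R * beta + (n%:R * beta ^+ 2 - M./2%:R * beta)) < t)%R%:R
    - ((uphalf M)%:R + M./2%:R) * t); first by lra.
  by rewrite /rotation_error; ring.
rewrite (_ : \sum_(i < N) _ = \sum_(i < N) visit (i %/ S)%N (i %% S)%N) //.
rewrite (divn_eq N S) -/M big_split_ord /= (sum_divn_modn visit) //; set rest := \sum_(i < N %% S) _.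
have rest_bound : 0 <= rest <= S%:R.
  rewrite /rest sumr_ge0 //=.
  apply: (@le_trans _ _ (\sum_(i < N %% S) 1)).
    by apply: ler_sum => i _; rewrite /visit; case: ltP.
  by rewrite sumr_const card_ord ler_nat ltnW // ltn_mod.
have columns : `|\sum_(n < S) \sum_(k < M) visit k n - (M * S)%:R * t|
    <= S%:R * (2 * B).
  have -> : (M * S)%:R * t = \sum_(n < S) M%:R * t :> R.
    by rewrite sumr_const card_ord natrM -mulr_natr; ring.
  rewrite -sumrB; apply: le_trans (ler_norm_sum _ _ _) _.
  apply: (@le_trans _ _ (\sum_(n < S) 2 * B)); first exact: ler_sum.
  by rewrite sumr_const card_ord -[leLHS]mulr_natl.
have rt : 0 <= (N %% S)%:R * t <= S%:R.
  have : (N %% S)%:R <= S%:R :> R by rewrite ler_nat ltnW // ltn_mod.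
  have : 0 <= (N %% S)%:R :> R by [].
  by move=> ? ?; apply/andP; split; nra.
move: columns rest_bound rt; rewrite !ler_norml natrD.
by move=> /andP[? ?] /andP[? ?] /andP[? ?]; apply/andP; split; lra.
Qed.

Lemma low_discrepancy_log {R : realType} (x : nat -> R) (A B : R) :
  0 <= A -> 0 < B -> (forall n, 0 <= x n < 1) ->
  (forall t N, 0 < t < 1 -> (0 < N)%N ->
    `|\sum_(n < N) (x n < t)%R%:R - N%:R * t| <= A + B * ln N%:R) ->
  low_discrepancy x.
Proof.
move=> A0 B0 x01 bound; split; first by move=> n; rewrite in_itv; exact: x01.
apply/eqO_exP; exists (A + B); first by lra.
near=> N.
have Ne : expR 1 <= N%:R :> R by near: N; exact: nbhs_infty_ger.
have NR : 0 < N%:R :> R by apply: lt_le_trans Ne; exact: expR_gt0.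
have ln1 : 1 <= ln (N%:R : R).
  by rewrite -[leLHS]expRK ler_ln ?posrE ?expR_gt0.
apply: le_trans (@star_discrepancy_le _ _ _ (A + B * ln N%:R) _ _ _) _.
- by rewrite -(ltr0n R).
- by move=> n; have /andP[] := x01 n.
- by move=> t t01; apply: bound; rewrite // -(ltr0n R).
have NV : 0 < N%:R^-1 :> R by rewrite invr_gt0.
rewrite ger0_norm; last by rewrite mulr_ge0 // ltW //; lra.
rewrite mulrCA mulrC ler_pM2l //; nra.
Unshelve. all: by end_near. Qed.

(* The hypothesis [infinite_set (J_LS beta)] is the proviso that there is a
   countably infinite set to order.  It excludes exactly the rational beta
   (e.g. L = 1, S = 2, beta = 1/2), for which the set is finite. *)
Theorem theorem3p6 (R : realType) (L S : nat) (hL : (1 <= L)%N)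
    (hS : (1 <= S)%N) (beta : R) (beta_gt0 : 0 < beta)
    (beta_eq : L%:R * beta + S%:R * beta ^+ 2 = 1)
    (J_infinite : infinite_set (J_LS beta)) :
  exists x : nat -> R, is_ordering (J_LS beta) x /\ low_discrepancy x.
Proof.
have irr := beta_irrational beta J_infinite.
exists (fun i => frac_part (interleaved S beta i)); split.
  exact: interleaved_ordering beta_eq irr.
have bad := beta_badly_approximable L S beta hS beta_gt0 beta_eq irr.
set c := _^-1 in bad.
have c01 : 0 < c < 1.
  have SR : 1 <= S%:R :> R by rewrite ler1n.
  have LR : 1 <= L%:R :> R by rewrite ler1n.
  have T1 : 1 < S%:R + 2 * S%:R * beta + L%:R by nra.
  by rewrite /c invr_gt0 invf_lt1 ?T1 ?andbT; lra.
have [K K0 err] := rotation_error_log c beta c01 bad.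
apply: (@low_discrepancy_log _ _ (9 * S%:R) (8 * S%:R * K)).
- by rewrite mulr_ge0.
- by rewrite !mulr_gt0 // ltr0n.
- by move=> n; exact: frac_part_itv.
- move=> t N t01 N0.
  have bound theta M : (M <= N)%N ->
      `|rotation_error beta t theta M| <= 4 * (1 + K * ln N%:R).
    move=> MN; apply: rotation_error_log_le K0 _ MN N0 => theta' M' M'0.
    exact: err.
  apply: le_trans (sum_visits_interleaved _ _ _ _ _ hS t01 bound) _.
  by rewrite le_eqVlt; apply/orP; left; apply/eqP; ring.
Qed.
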